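(* Let $(Y_k)_{k\in\mathbb{N}}$ be a strongly stationary sequence of real random variables, $S_n:=Y_1+\cdots+Y_n$ for $n\in\mathbb{N}$, $S_0:=0$, and assume the following. (i) $(Y_k)_{k\in\mathbb{N}}$ is jointly regularly varying with some index $\alpha\in(0,2)$, and $(a_n)_{n\in\mathbb{N}}$ is a sequence in $(0,\infty)$ with $n\,\mathbb{P}(|Y_1|>a_n)\to1$ as $n\to\infty$. (ii) $(m_n)_{n\in\mathbb{N}}$ is a sequence in $\mathbb{N}$ with $m_n\to\infty$ and $\lfloor n/m_n\rfloor\to\infty$ as $n\to\infty$ such that for each $d\in\mathbb{N}$, $\vartheta_1,\ldots,\vartheta_d\in\mathbb{R}$ and $t_1,\ldots,t_d\in[0,\infty)$ with $0=:t_0<t_1<\cdots<t_d$, $$\Bigl|\varphi_{n,\lfloor nt_1\rfloor,\ldots,\lfloor nt_d\rfloor}(\vartheta_1,\ldots,\vartheta_d)-\prod_{\ell=1}^d\bigl(\varphi_{n,m_n}(\vartheta_\ell)\bigr)^{\lfloor(\lfloor nt_\ell\rfloor-\lfloor nt_{\ell-1}\rfloor)/m_n\rfloor}\Bigr|\to0\qquad\text{as }n\to\infty.$$ (iii) For all $x\in(0,\infty)$, $$\lim_{d\to\infty}\limsup_{n\to\infty}n\sum_{j=d+1}^{m_n}\mathbb{E}\bigl((|a_n^{-1}Y_j|\wedge x)(|a_n^{-1}Y_0|\wedge x)\bigr)=0 .$$ Then for all $\vartheta\in\mathbb{R}$, $$\lim_{d\to\infty}\limsup_{n\to\infty}\frac{n}{m_n}\sum_{j=d+1}^{m_n}\mathbb{E}\bigl(\bigl|\overline{\vartheta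 a_n^{-1}(S_j-S_d)}\cdot\overline{\vartheta a_n^{-1}Y_1}\bigr|\bigr)=0,$$ where, for any random variable $Z$, $\overline{Z}:=(Z\wedge2)\vee(-2)$.
   Context: Notation: $\mathbb{N}$ is the set of positive integers; $x\wedge y=\min(x,y)$, $x\vee y=\max(x,y)$. Strongly stationary means that all finite dimensional distributions are invariant under time shifts; $Y_0$ is the time-$0$ variable of the strongly stationary extension $(\ldots,Y_{-1},Y_0,Y_1,\ldots)$ of $(Y_k)_{k\in\mathbb{N}}$. For $d\in\mathbb{N}$ and non-negative integers $j_1\leq\cdots\leq j_d$, with $j_0:=0$, $$\varphi_{n,j_1,\ldots,j_d}(\vartheta_1,\ldots,\vartheta_d):=\mathbb{E}\Bigl(\exp\Bigl\{\frac{i}{a_n}\sum_{\ell=1}^d\vartheta_\ell(S_{j_\ell}-S_{j_{\ell-1}})\Bigr\}\Bigr),\qquad\vartheta_1,\ldots,\vartheta_d\in\mathbb{R}.$$ A $d$-dimensional random vector $\boldsymbol{Y}$ is regularly varying with index $\alpha\in(0,\infty)$ if there is a probability measure $\psi$ on the unit sphere $\mathbb{S}^{d-1}=\{x\in\mathbb{R}^d:\|x\|=1\}$ such that for all $c\in(0,\infty)$ the finite measures $\mathbb{P}(\|\boldsymbol{Y}\|>cx,\ \boldsymbol{Y}/\|\boldsymbol{Y}\|\in\cdot)/\mathbb{P}(\|\boldsymbol{Y}\|>x)$ converge weakly to $c^{-\alpha}\psi(\cdot)$ as $x\to\infty$. A process $(Y_k)_{k\in\mathbb{N}}$ is jointly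 regularly varying with index $\alpha$ if all its finite dimensional distributions are regularly varying with index $\alpha$. *)

(* Defs.v *)
From HB Require Import structures.
From mathcomp Require Import all_boot all_order all_algebra.
From mathcomp Require Import complex.
From mathcomp Require Import all_classical all_reals all_analysis.

Set Implicit Arguments.
Unset Strict Implicit.
Unset Printing Implicit Defensive.

Import Order.TTheory GRing.Theory Num.Theory.
Import numFieldNormedType.Exports.

Local Open Scope classical_set_scope.
Local Open Scope ring_scope.

(* R^d is represented by [d.-tuple R], whose sigma-algebra is the one generated
   by the coordinates, i.e. the Borel one.  A process indexed by the positive
   integers is a family [Y : nat -> _] of which [Y 0] is never used. *)

Section Vectors.
Context {R : realType} {d : nat}.

Definition tuple_of_row (v : 'rV[R]_d) : d.-tuple R := [tuple v ord0 i | i < d].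

Definition enorm (y : d.-tuple R) : R :=
  Num.sqrt (\sum_(i < d) tnth y i ^+ 2).

Definition sphere : set (d.-tuple R) := [set y | enorm y = 1].

Definition normalize (y : d.-tuple R) : d.-tuple R :=
  [tuple tnth y i / enorm y | i < d].

(* Weak convergence, as x tends to infinity, of finite measures on the subspace
   S of R^d.  The topology of R^d is that of ['rV[R]_d]. *)
Definition weak_cvg_on (S : set (d.-tuple R))
    (mu : R -> set (d.-tuple R) -> \bar R) (nu : set (d.-tuple R) -> \bar R) :=
  forall f : d.-tuple R -> R,
    {within tuple_of_row @^-1` S, continuous (f \o tuple_of_row)} ->
    (exists M : R, forall y, S y -> `|f y| <= M) ->
    (\int[mu x]_(y in S) (f y)%:E)%E @[x --> +oo]
      --> (\int[nu]_(y in S) (f y)%:E)%E.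

End Vectors.
Arguments sphere : clear implicits.

(* If P(||X|| > x) vanished for arbitrarily large x, the convergence below would
   fail: the measures would be 0 by the convention 0^-1 = 0, whereas the limit
   has mass c^(-alpha) > 0. *)
Definition regularly_varying {disp : measure_display} {T : measurableType disp}
    {R : realType} (P : probability T R) {d : nat} (X : T -> d.-tuple R)
    (alpha : R) : Prop :=
  0 < alpha /\
  exists psi : probability (d.-tuple R) R,
    psi (sphere R d) = 1%E /\
    forall c : R, 0 < c ->
      weak_cvg_on (sphere R d)
        (fun x A =>
           (P [set w | (c * x < enorm (X w))%R /\ A (normalize (X w))]
             * ((fine (P [set w | (x < enorm (X w))%R]))^-1)%:E)%E)
        (fun A => ((c `^ (- alpha))%:E * psi A)%E).

Definition rvec {T I : Type} {R : realType} (Y : I -> T -> R) {d : nat}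
    (k : d.-tuple I) (w : T) : d.-tuple R :=
  [tuple Y (tnth k l) w | l < d].

Definition eq_law {disp disp' : measure_display} {T : measurableType disp}
    {T' : measurableType disp'} {R : realType} (P : probability T R)
    (P' : probability T' R) {d : nat} (X : T -> d.-tuple R)
    (X' : T' -> d.-tuple R) : Prop :=
  forall A : set (d.-tuple R), measurable A ->
    pushforward P X A = pushforward P' X' A.

Definition jointly_regularly_varying {disp : measure_display}
    {T : measurableType disp} {R : realType} (P : probability T R)
    (Y : nat -> T -> R) (alpha : R) : Prop :=
  forall (d : nat) (k : d.-tuple nat), (0 < d)%N -> path ltn 0%N k ->
    regularly_varying P (rvec Y k) alpha.

Definition strongly_stationary {disp : measure_display}
    {T : measurableType disp} {R : realType} (P : probability T R)
    (Y : nat -> T -> R) : Prop :=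
  forall (d : nat) (k : d.-tuple nat) (h : nat), path ltn 0%N k ->
    eq_law P P (rvec Y k) (rvec Y [tuple (tnth k l + h)%N | l < d]).

Definition strongly_stationary_int {disp : measure_display}
    {T : measurableType disp} {R : realType} (P : probability T R)
    (Z : int -> T -> R) : Prop :=
  forall (d : nat) (k : d.-tuple int) (h : int), sorted <%R k ->
    eq_law P P (rvec Z k) (rvec Z [tuple tnth k l + h | l < d]).

(* The two-sided extension is only determined up to its law, and may live on
   another probability space. *)
Definition stationary_extension {disp disp' : measure_display}
    {T : measurableType disp} {T' : measurableType disp'} {R : realType}
    (P : probability T R) (Y : nat -> T -> R)
    (Q : probability T' R) (Z : int -> T' -> R) : Prop :=
  strongly_stationary_int Q Z /\
  forall (d : nat) (k : d.-tuple nat), path ltn 0%N k ->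
    eq_law P Q (rvec Y k) (rvec Z [tuple (tnth k l)%:Z | l < d]).

Definition psum {T : Type} {R : realType} (Y : nat -> T -> R) (n : nat) (w : T)
  : R := \sum_(1 <= k < n.+1) Y k w.

Definition cexpectation {disp : measure_display} {T : measurableType disp}
    {R : realType} (P : probability T R) (Z : T -> R[i]) : R[i] :=
  (fine 'E_P[fun w => complex.Re (Z w)]
     +i* fine 'E_P[fun w => complex.Im (Z w)])%C.

(* exp (i t) *)
Definition expi {R : realType} (t : R) : R[i] := (cos t +i* sin t)%C.

(* For l = 0, ..., d-1, the predecessor of [tnth j l], with 0 before the first
   entry. *)
Definition prevj {d : nat} (j : d.-tuple nat) (l : 'I_d) : nat :=
  nth 0%N (0%N :: j) l.

Definition phi {disp : measure_display} {T : measurableType disp}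
    {R : realType} (P : probability T R) (Y : nat -> T -> R) (a : nat -> R)
    (n : nat) {d : nat} (j : d.-tuple nat) (theta : d.-tuple R) : R[i] :=
  cexpectation P (fun w => expi ((a n)^-1 *
    \sum_(l < d) tnth theta l * (psum Y (tnth j l) w - psum Y (prevj j l) w))).

Definition clip2 {R : realType} (z : R) : R := Num.max (Num.min z 2) (- 2).

(* Main.v *)
Require Import Defs.
From HB Require Import structures.
From mathcomp Require Import all_boot all_order all_algebra.
From mathcomp Require Import complex lra.
From mathcomp Require Import all_classical all_reals all_analysis.
From mathcomp Require Import measurable_realfun.
Import Order.TTheory GRing.Theory Num.Theory.
Import numFieldNormedType.Exports.
Local Open Scope classical_set_scope.
Local Open Scope ring_scope.

(** The left-hand side is bounded, for each fixed n, by a constant multiple of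
    the quantity that [anticlustering] controls.

    Fix K > 0 with |theta| <= K and let g(y) = min(|y / a_n|, 2/K).  Clipping at
    level 2 is the truncation min(|.|, 2) in absolute value, and truncations of
    absolute values are subadditive, so that the clipped increment S_j - S_d is
    at most the sum of the K g(Y_i) over d < i <= j, whereas the clipped Y_1 is
    at most K g(Y_1) ([normr_clip2_sum_le], [normr_clip2_le]).  The expectation
    for a given j is therefore at most K^2 times the sum of the E(g(Y_i) g(Y_1))
    over d < i <= j ([expectation_clip2_sum_le]).  By stationarity, E(g(Y_i)
    g(Y_1)) = E(g(Y_(i-1)) g(Y_0)) ([expectation_stationary_pair]), and
    enlarging the range of i gives a bound that no longer depends on j, namely
    K^2 times the sum of the E(g(Y_i) g(Y_0)) over d <= i <= m_n.  There are at
    most m_n values of j, which compensates for the factor 1 / m_n and leaves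
    K^2 times the quantity of [anticlustering] with x = 2/K and d - 1 in place
    of d ([mean_clip2_sum_le]).  The index shift is harmless as d tends to
    infinity. *)

Lemma normr_clip2 {R : realType} (z : R) : `|clip2 z| = Num.min `|z| 2.
Proof.
rewrite /clip2; case: (lerP z 2) => z2; last first.
  rewrite max_l; last by lra.
  by rewrite !ger0_norm ?min_r//; lra.
case: (lerP (- 2) z) => zN2; first by rewrite min_l// ler_norml zN2.
by rewrite normrN normr_nat ltr0_norm ?min_r//; lra.
Qed.

(** The function min(|.|, M) is subadditive because it is nondecreasing and concave
    in |.| and vanishes at 0. *)
Lemma minr_normD {R : realType} (x y M : R) : 0 <= M ->
  Num.min `|x + y| M <= Num.min `|x| M + Num.min `|y| M.
Proof.
move=> M0; have := ler_normD x y; have := normr_ge0 y; have := normr_ge0 x.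
by case: (lerP `|x| M); case: (lerP `|y| M); case: (lerP `|x + y| M);
  move=> *; lra.
Qed.

Lemma minr_norm_sum {R : realType} {I : Type} (s : seq I) (f : I -> R) (M : R) :
  0 <= M ->
  Num.min `|\sum_(i <- s) f i| M <= \sum_(i <- s) Num.min `|f i| M.
Proof.
move=> M0; elim/big_rec2 : _ => [|i y x _ xy]; first by rewrite normr0 min_l.
by apply: le_trans (minr_normD _ _ _ M0) _; rewrite lerD2l.
Qed.

(** Taking K to be any positive bound of |t|, rather than |t| itself, covers
    t = 0, for which the truncation level 2 / |t| would be meaningless. *)
Lemma normr_clip2_le {R : realType} (K t z : R) : `|t| <= K -> 0 < K ->
  `|clip2 (t * z)| <= K * Num.min `|z| (2 / K).
Proof.
move=> tK K0; rewrite normr_clip2 normrM minr_pMr; last exact: ltW.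
rewrite [K * (2 / K)]mulrC divfK ?gt_eqF//.
by rewrite le_min !ge_min lexx orbT ler_wpM2r.
Qed.

Lemma normr_clip2_sum_le {R : realType} {I : Type} (s : seq I) (f : I -> R)
    (K t : R) : `|t| <= K -> 0 < K ->
  `|clip2 (t * \sum_(i <- s) f i)| <=
    \sum_(i <- s) K * Num.min `|f i| (2 / K).
Proof.
move=> tK K0; apply: le_trans (normr_clip2_le _ _ _ tK K0) _.
by rewrite -mulr_sumr ler_pM2l// minr_norm_sum// divr_ge0// ltW.
Qed.

Lemma limn_esup_leZ {R : realType} (K : R) (u v : nat -> \bar R) : 0 < K ->
  (forall n, u n <= K%:E * v n)%E ->
  (limn_esup u <= K%:E * limn_esup v)%E.
Proof.
move=> K0 uv; rewrite -lee_pdivrMl//.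
apply: le_ereal_inf_tmp => _ [V V_oo <-]; rewrite lee_pdivrMl//.
apply: (@le_trans _ _ (ereal_sup (u @` V))).
  by apply: ereal_inf_lbound; exists V.
apply: ge_ereal_sup => _ [n Vn <-]; apply: le_trans (uv n) _.
by rewrite lee_pmul2l//; apply: ereal_sup_ubound; exists n.
Qed.

Lemma measurable_rvec {disp} {T : measurableType disp} {R : realType}
    {P : probability T R} {I : Type} (Y : I -> {RV P >-> R}) {d : nat}
    (k : d.-tuple I) : measurable_fun setT (rvec Y k).
Proof.
apply/measurable_fun_tnthP => l.
rewrite (_ : _ \o _ = Y (tnth k l)) //.
by apply/funext => w /=; rewrite tnth_mktuple.
Qed.

Lemma expectation_eq_law {disp disp' : measure_display}
    {T : measurableType disp} {T' : measurableType disp'} {R : realType}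
    (P : probability T R) (P' : probability T' R) {d : nat}
    (X : T -> d.-tuple R) (X' : T' -> d.-tuple R) (f : d.-tuple R -> R) :
  measurable_fun setT X -> measurable_fun setT X' -> eq_law P P' X X' ->
  measurable_fun setT f -> (forall y, 0 <= f y) ->
  ('E_P[fun w => f (X w)] = 'E_P'[fun w => f (X' w)])%E.
Proof.
move=> mX mX' XX' mf f0; rewrite unlock.
have mfE : measurable_fun setT (EFin \o f) by exact/measurable_EFinP.
have f0E : {in setT, forall y, 0 <= (f y)%:E}%E by move=> y _; rewrite lee_fin.
have := ge0_integral_pushforward mX P measurableT mfE f0E.
have := ge0_integral_pushforward mX' P' measurableT mfE f0E.
rewrite !preimage_setT => <- <-.
by apply: eq_measure_integral => A mA _; exact: XX'.
Qed.

(** The extension need not live on the same space as Y, so the law is transported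
    in two steps: (Y_1, Y_(i+1)) has the law of (Z_1, Z_(i+1)), which has that of
    (Z_0, Z_i).  The hypothesis [0 < i] keeps the two time indices distinct and
    increasing, as the assumptions on finite dimensional laws demand. *)
Lemma expectation_stationary_pair {disp disp' : measure_display}
    {T : measurableType disp} {T' : measurableType disp'} {R : realType}
    (P : probability T R) (Y : nat -> {RV P >-> R})
    (Q : probability T' R) (Z : int -> {RV Q >-> R}) (g : R -> R) (i : nat) :
  stationary_extension P Y Q Z -> measurable_fun setT g ->
  (forall y, 0 <= g y) -> (0 < i)%N ->
  ('E_P[fun w => (g (Y i.+1 w) * g (Y 1%N w))%R] =
   'E_Q[fun w => (g (Z i%:Z w) * g (Z 0%R w))%R])%E.
Proof.
move=> [Zstat YZ] mg g0 i0.
pose f (y : 2.-tuple R) := g (tnth y ord_max) * g (tnth y ord0).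
have mf : measurable_fun setT f.
  by apply: measurable_funM; apply: measurableT_comp => //; exact: measurable_tnth.
have f0 y : 0 <= f y by rewrite mulr_ge0.
have YZ1 := YZ 2 [tuple 1%N; i.+1] ltac:(by rewrite /= ltnS i0).
have ZZ := Zstat 2 [tuple 0; i%:Z] 1 ltac:(by rewrite /= andbT ltz_nat).
have eqY := expectation_eq_law P Q _ _ f
  (measurable_rvec _ _) (measurable_rvec _ _) YZ1 mf f0.
have eqZ := expectation_eq_law Q Q _ _ f
  (measurable_rvec _ _) (measurable_rvec _ _) ZZ mf f0.
transitivity ('E_P[fun w => f (rvec Y [tuple 1%N; i.+1] w)])%E.
  by congr expectation; apply/funext => w; rewrite /f !tnth_mktuple !(tnth_nth 0%N).
transitivity ('E_Q[fun w => f (rvec Z [tuple 0%R; i%:Z] w)])%E; last first.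
  by congr expectation; apply/funext => w; rewrite /f !tnth_mktuple !(tnth_nth 0).
rewrite eqY eqZ; congr expectation; apply/funext => w.
rewrite /f !tnth_mktuple (tnth_nth 0) /= (tnth_nth 0) /=.
by rewrite add0r addrC -intS.
Qed.

Lemma psumB {T : Type} {R : realType} (Y : nat -> T -> R) (d j : nat) (w : T) :
  (d <= j)%N -> psum Y j w - psum Y d w = \sum_(d.+1 <= i < j.+1) Y i w.
Proof.
move=> dj; rewrite /psum (@big_cat_nat _ _ _ d.+1 1 j.+1)//=.
by rewrite addrAC subrr add0r.
Qed.

Lemma measurable_minr_normM {R : realType} (b M : R) :
  measurable_fun setT (fun y : R => Num.min `|b * y| M).
Proof. by apply: measurable_minr => //; exact: measurableT_comp. Qed.

Lemma measurable_clip2 {R : realType} : measurable_fun setT (@clip2 R).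
Proof. by apply: measurable_maxr => //; exact: measurable_minr. Qed.

Lemma expectation_clip2_sum_le {disp : measure_display}
    {T : measurableType disp} {R : realType} (P : probability T R) {I : Type}
    (s : seq I) (X : I -> {RV P >-> R}) (V : {RV P >-> R}) (b theta K : R) :
  `|theta| <= K -> 0 < K ->
  ('E_P[fun w => `|clip2 (theta * b * \sum_(i <- s) X i w) *
                   clip2 (theta * b * V w)|%R] <=
   \sum_(i <- s) (K ^+ 2)%:E *
     'E_P[fun w => (Num.min `|b * X i w| (2 / K) *
                    Num.min `|b * V w| (2 / K))%R])%E.
Proof.
move=> thetaK K0.
pose g (y : R) := Num.min `|b * y| (2 / K).
have g0 y : 0 <= g y by rewrite le_min normr_ge0 divr_ge0// ltW.
have mgX i : measurable_fun setT (fun w => g (X i w)).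
  by apply: measurableT_comp => //; exact: measurable_minr_normM.
have mgV : measurable_fun setT (fun w => g (V w)).
  by apply: measurableT_comp => //; exact: measurable_minr_normM.
have intK i : ((K ^+ 2)%:E * 'E_P[fun w => (g (X i w) * g (V w))%R] =
    \int[P]_w (K ^+ 2 * (g (X i w) * g (V w)))%:E)%E.
  rewrite unlock -ge0_integralZl//.
  - by apply/measurable_EFinP; exact: measurable_funM.
  - by move=> w _; rewrite lee_fin mulr_ge0.
  - by rewrite lee_fin sqr_ge0.
under eq_bigr do rewrite intK.
rewrite unlock -ge0_integral_sum//; last 2 first.
- move=> i; apply/measurable_EFinP; apply: measurable_funM => //.
  exact: measurable_funM.
- by move=> i w _; rewrite lee_fin mulr_ge0 ?sqr_ge0 ?mulr_ge0.
apply: ge0_le_integral => //.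
- apply/measurable_EFinP; apply: measurableT_comp => //.
  apply: measurable_funM; apply: measurableT_comp measurable_clip2 _.
    by apply: measurable_funM => //; exact: measurable_sum.
  exact: measurable_funM.
- apply: emeasurable_sum => i; apply/measurable_EFinP.
  by apply: measurable_funM => //; exact: measurable_funM.
move=> w _; rewrite sumEFin lee_fin normrM -!(mulrA theta) mulr_sumr.
apply: le_trans (ler_pM _ _ (normr_clip2_sum_le _ _ _ _ thetaK K0)
  (normr_clip2_le _ _ _ thetaK K0)) _ => //.
rewrite mulr_suml; apply: ler_sum => i _.
by rewrite mulrACA expr2.
Qed.

(** The bound of the j-th term is enlarged to a sum over all i up to m, so that
    it no longer depends on j; summing over the at most m values of j then costs
    a factor m, which the averaging by 1 / m absorbs.  The lower end of the range
    drops from [d.+2] to [d.+1] because time is shifted by one to bring Y_1 to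
    Z_0. *)
Lemma mean_clip2_sum_le {R : realType}
    {disp : measure_display} {T : measurableType disp} (P : probability T R)
    (Y : nat -> {RV P >-> R})
    {disp' : measure_display} {T' : measurableType disp'} (Q : probability T' R)
    (Z : int -> {RV Q >-> R}) (b theta K : R) (d m n : nat) :
  stationary_extension P Y Q Z -> `|theta| <= K -> 0 < K ->
  ((n%:R / m%:R)%R%:E * \sum_(d.+2 <= j < m.+1)
     'E_P[fun w => (`|clip2 (theta * b * (psum Y j w - psum Y d.+1 w)) *
                      clip2 (theta * b * Y 1%N w)|)%R] <=
   (K ^+ 2)%:E * (n%:R%:E * \sum_(d.+1 <= j < m.+1)
     'E_Q[fun w => (Num.min `|b * Z j%:Z w| (2 / K) *
                    Num.min `|b * Z 0%R w| (2 / K))%R]))%E.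
Proof.
move=> YZ thetaK K0.
pose g (y : R) := Num.min `|b * y| (2 / K).
have g0 y : 0 <= g y by rewrite le_min normr_ge0 divr_ge0// ltW.
pose e i := ('E_Q[fun w => (g (Z i%:Z w) * g (Z 0%R w))%R])%E.
have e0 i : (0 <= e i)%E by apply: expectation_ge0 => w; rewrite mulr_ge0.
pose S := (\sum_(d.+1 <= i < m.+1) e i)%E.
have S0 : (0 <= S)%E by exact: sume_ge0.
have term j : (d.+1 < j <= m)%N ->
  ('E_P[fun w => (`|clip2 (theta * b * (psum Y j w - psum Y d.+1 w)) *
                    clip2 (theta * b * Y 1%N w)|)%R] <=
    (K ^+ 2)%:E * S)%E.
  move=> /andP[dj jm].
  apply: (@le_trans _ _ (\sum_(d.+2 <= i < j.+1)
      (K ^+ 2)%:E * 'E_P[fun w => (g (Y i w) * g (Y 1%N w))%R])%E).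
    under [X in expectation _ X]eq_fun do rewrite (psumB _ _ _ _ (ltnW dj)).
    exact: expectation_clip2_sum_le.
  rewrite -ge0_sume_distrr; last first.
    by move=> i _; apply: expectation_ge0 => w; rewrite mulr_ge0.
  rewrite lee_pmul2l ?lte_fin ?exprn_gt0// big_add1/=.
  under eq_big_nat => i /andP[di _].
    rewrite (expectation_stationary_pair _ _ _ _ _ _ YZ
      (measurable_minr_normM b (2 / K)) g0 (leq_trans _ di))//.
    over.
  by apply: lee_sum_nneg_natr => [i _ _|]; [exact: e0|exact: leqW].
apply: (@le_trans _ _ ((n%:R / m%:R)%:E * (m%:R%:E * ((K ^+ 2)%:E * S)))%E).
  rewrite lee_wpmul2l ?lee_fin ?divr_ge0//.
  apply: (@le_trans _ _ (\sum_(d.+2 <= j < m.+1) (K ^+ 2)%:E * S)%E).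
    rewrite big_nat_cond [leRHS]big_nat_cond; apply: lee_sum => j.
    by rewrite andbT ltnS; exact: term.
  rewrite -{1}[((K ^+ 2)%:E * S)%E]mul1e.
  rewrite -ge0_sume_distrl// sumEFin sumr_const_nat.
  rewrite lee_wpmul2r ?mule_ge0 ?lee_fin ?sqr_ge0//.
  by rewrite ler_nat subSS; exact: leq_subr.
rewrite !muleA -EFinM; apply: lee_wpmul2r => //.
rewrite lee_fin [leRHS]mulrC ler_wpM2r ?sqr_ge0//.
(* For m = 0 the left-hand side is 0, as 0^-1 = 0. *)
by case: m {term S S0} => [|m]; [rewrite mulr0 | rewrite divfK].
Qed.

Theorem lemma2p5 (R : realType)
    (disp : measure_display) (T : measurableType disp) (P : probability T R)
    (Y : nat -> {RV P >-> R})
    (disp' : measure_display) (T' : measurableType disp') (Q : probability T' R)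
    (Z : int -> {RV Q >-> R})
    (alpha : R) (a : nat -> R) (m : nat -> nat)
    (Ystat : strongly_stationary P Y)
    (YZ : stationary_extension P Y Q Z)
    (alpha02 : 0 < alpha < 2)
    (Yrv : jointly_regularly_varying P Y alpha)
    (a_gt0 : forall n : nat, (0 < n)%N -> 0 < a n)
    (a_tail : (n%:R%:E * P [set w | (a n < `|Y 1%N w|)%R])%E @[n --> \oo] --> 1%E)
    (m_gt0 : forall n : nat, (0 < n)%N -> (0 < m n)%N)
    (m_oo : m n @[n --> \oo] --> \oo)
    (nm_oo : (n %/ m n)%N @[n --> \oo] --> \oo)
    (mixing : forall (d : nat) (theta t : d.-tuple R), (0 < d)%N ->
      path <%R 0 t ->
      let j n := [tuple Num.truncn (n%:R * tnth t l) | l < d] in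
      Normc.normc (phi P Y a n (j n) theta -
        \prod_(l < d) phi P Y a n [tuple m n] [tuple tnth theta l]
          ^+ ((tnth (j n) l - prevj (j n) l) %/ m n)) @[n --> \oo] --> (0 : R))
    (anticlustering : forall x : R, 0 < x ->
      limn_esup (fun n : nat =>
        n%:R%:E * \sum_(d.+1 <= j < (m n).+1)
          'E_Q[fun w => (Num.min `|(a n)^-1 * Z j%:Z w| x *
                         Num.min `|(a n)^-1 * Z 0 w| x)%R])%E
        @[d --> \oo] --> 0%E) :
  forall theta : R,
    limn_esup (fun n : nat =>
      (n%:R / (m n)%:R)%R%:E * \sum_(d.+1 <= j < (m n).+1)
        'E_P[fun w => (`|clip2 (theta * (a n)^-1 * (psum Y j w - psum Y d w)) *
                         clip2 (theta * (a n)^-1 * Y 1%N w)|)%R])%E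
      @[d --> \oo] --> 0%E.
Proof.
(* Adding 1 makes K positive even when theta = 0. *)
move=> theta; pose K := `|theta| + 1.
have K0 : 0 < K by rewrite ltr_wpDl.
have thetaK : `|theta| <= K by rewrite lerDl.
have /(cvgeZl (y := (K ^+ 2)%:E) isT) := anticlustering _ (divr_gt0 (ltr0Sn R 1) K0).
rewrite mule0 => bound0.
rewrite -cvg_shiftS/=.
apply: squeeze_cvge (cvg_cst 0%E) bound0.
apply: nearW => d; apply/andP; split.
  apply: limf_esup_ge0 => [|n]; first exact: filter_not_empty.
  apply: mule_ge0; first by rewrite lee_fin divr_ge0.
  by apply: sume_ge0 => j _; apply: expectation_ge0.
by apply: limn_esup_leZ => [|n]; [rewrite exprn_gt0 | exact: mean_clip2_sum_le].
Qed.
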